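(* Every graph $G$ with $n\ge 1$ vertices has a $\delta_k$-obstacle representation for $k=\lceil n/2\rceil$.
   Context: Graphs are finite, simple and undirected. For an integer $k\ge 2$ let $N_k=\{v_i=(\cos(i\pi/k),\sin(i\pi/k)) : i\in\{0,\dots,2k-1\}\}$ and let $\delta_k(p,q)=\min\{\sum_i |a_i| : q-p=\sum_i a_i v_i\}$ for $p,q\in\mathbb{R}^2$; its unit ball is a regular $2k$-gon. For $x\in\mathbb{R}^2$ and $i\in\{0,\dots,2k-1\}$ the $i$-sector of $x$ is the closed cone $Q^k_i(x)=x+\{r(\cos\theta,\sin\theta): r\ge 0,\ i\pi/k\le\theta\le (i+1)\pi/k\}$ (the cone spanned by one facet of the $2k$-gon, translated to $x$). A curve is a continuous map $f:[0,1]\to\mathbb{R}^2$ with endpoints $f(0),f(1)$ and image $f([0,1])$. A curve $f$ is $\delta_k$-monotone if for some $i$ we have $f(b)\in Q^k_i(f(a))$ for all $0\le a\le b\le 1$. For $k=1$, $\delta_1(p,q)$ is the absolute difference of the $x$-coordinates of $p$ and $q$, and a curve is $\delta_1$-monotone if its $x$-coordinate is a monotone function of the parameter. The geodesics for $\delta_k$ are the $\delta_k$-monotone curves. A $\delta_k$-obstacle representation of a graph $G$ is a pair $(\varphi,S)$, where $\varphi:V(G)\to\mathbb{R}^2$ is injective and $S$ is a set of connected subsets of $\mathbb{R}^2$ (obstacles), such that for all distinct $u,w\in V(G)$: $uw\in E(G)$ if and only if there is a geodesic for $\delta_k$ with endpoints $\varphi(u)$ and $\varphi(w)$ whose image is disjoint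 from $\bigcup S$. *)

(* Defs.v *)
From HB Require Import structures.
From mathcomp Require Import all_boot all_order all_algebra.
From mathcomp Require Import all_classical all_reals all_analysis.

Set Implicit Arguments.
Unset Strict Implicit.
Unset Printing Implicit Defensive.

Import Order.TTheory GRing.Theory Num.Theory.
Import numFieldNormedType.Exports.

Local Open Scope classical_set_scope.
Local Open Scope ring_scope.

Section ObstacleRepresentation.
Variable R : realType.

Definition sector (k i : nat) (x : R * R) : set (R * R) :=
  [set p | exists r theta : R,
    [/\ 0 <= r, i%:R * pi / k%:R <= theta, theta <= i.+1%:R * pi / k%:R &
        p = (x.1 + r * cos theta, x.2 + r * sin theta)]].

(* Only the values on [0, 1] matter. *)
Definition is_curve (f : R -> R * R) : Prop :=
  {within `[0, 1], continuous f}.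

Definition x_monotone (f : R -> R * R) : Prop :=
  (forall a b : R, 0 <= a -> a <= b -> b <= 1 -> (f a).1 <= (f b).1) \/
  (forall a b : R, 0 <= a -> a <= b -> b <= 1 -> (f b).1 <= (f a).1).

Definition sector_monotone (k : nat) (f : R -> R * R) : Prop :=
  exists2 i : nat, (i < 2 * k)%N &
    forall a b : R, 0 <= a -> a <= b -> b <= 1 -> sector k i (f a) (f b).

(* The case k = 1 is special: delta_1 is the distance of the x-coordinates,
   not a polygonal metric.  No sector exists for k = 0, which is not used. *)
Definition delta_monotone (k : nat) (f : R -> R * R) : Prop :=
  if k == 1%N then x_monotone f else sector_monotone k f.

(* The geodesics for the polygonal (pseudo)metric delta_k are the
   delta_k-monotone curves. *)
Definition geodesic (k : nat) (f : R -> R * R) : Prop :=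
  is_curve f /\ delta_monotone k f.

Definition obstacle_representation (k : nat) (V : finType) (E : rel V)
    (phi : V -> R * R) (S : set (set (R * R))) : Prop :=
  [/\ injective phi,
      forall A, S A -> connected A &
      forall u w : V, u != w ->
        (E u w <->
         exists f : R -> R * R,
           [/\ geodesic k f, f 0 = phi u, f 1 = phi w &
               f @` `[0, 1] `&` \bigcup_(A in S) A = set0])].

End ObstacleRepresentation.

(* Main.v *)
(** Place the vertices at corners of a regular 2k-gon, draw every edge as a
    straight chord, and let every point off the drawing be an obstacle.  In
    coordinates adapted to one sector (its axis vertical), the rotation of the
    polygon makes the corners alternate above and below the horizontal diameter
    when read from right to left, and the chords whose direction lies in the
    sector are exactly those joining horizontally consecutive corners.  A curve
    monotone for that sector meets every other chord in at most one point, so by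
    connectedness it runs inside the zigzag of these consecutive chords, where
    the height alternates at every corner.  Being monotone in height, it cannot
    pass a corner, so it runs along a single chord. *)

Require Import Defs.
From mathcomp Require Import all_boot all_order all_algebra.
From mathcomp Require Import all_classical all_reals all_analysis.
From mathcomp Require Import ring lra zify.

Set Implicit Arguments.
Unset Strict Implicit.
Unset Printing Implicit Defensive.

Import Order.TTheory GRing.Theory Num.Theory.
Import numFieldNormedType.Exports.

Local Open Scope classical_set_scope.
Local Open Scope ring_scope.

(** * Connected sets and reversed curves *)

(** In a T1 space the finite set [X]\[Z] is closed. Removing it from [I] leaves exactly [I]&[Z],
    which is therefore open as well as closed in [I], and nonempty. *)
Lemma connected_sub_closed (T : topologicalType) (I Z X : set T) :
  accessible_space T -> connected I -> closed Z -> finite_set X ->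
  I `<=` Z `|` X -> I `&` Z !=set0 -> I `<=` Z.
Proof.
move=> accT cI cZ fX sI neIZ.
have cXZ : closed (X `\` Z).
  by apply: (accessible_finite_set_closed.1 accT); exact: finite_setD.
suff -> : I = I `&` Z by [].
apply/esym/cI => //; last by exists Z.
exists (~` (X `\` Z)); first exact: closed_openC.
apply/seteqP; split=> p /= [Ip].
  by move=> Zp; split => // -[_].
by move=> nXZ; split => //; have [//|Xp] := sI p Ip; apply: contrapT => nZ; apply: nXZ.
Qed.

Lemma within_continuous_flip (R : realType) (U : topologicalType) (f : R -> U) :
  {within `[0, 1], continuous f} ->
  {within `[0, 1], continuous (fun t => f (1 - t))}.
Proof.
move=> /subspace_continuousP fc; apply/subspace_continuousP => t t01.
have t01' : `[0, 1]%classic (1 - t).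
  by move: t01; rewrite /= !in_itv /= => /andP[? ?]; apply/andP; split; lra.
have fc1 := fc _ t01'.
suff flipW : (1 - s) @[s --> within `[0, 1]%classic (nbhs t)] -->
    within `[0, 1]%classic (nbhs (1 - t)) by exact: cvg_comp flipW fc1.
have flip : (1 - s) @[s --> t] --> 1 - t.
  by apply: cvgB; [exact: cvg_cst | exact: cvg_id].
move=> P nP.
have nP' : nbhs t (fun s : R => `[0, 1]%classic (1 - s) -> P (1 - s)) := flip _ nP.
suff : nbhs t (fun s : R => `[0, 1]%classic s -> P (1 - s)) by [].
apply: filterS nP' => s /= + s01; apply.
by move: s01; rewrite !in_itv /= => /andP[? ?]; apply/andP; split; lra.
Qed.

(** * Segments and linear coordinates in the plane *)

Section PlaneGeometry.
Variable R : realType.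
Implicit Types (x y p : (R * R)%type) (c t : R).

Definition seg_point x y t : R * R :=
  (x.1 + t * (y.1 - x.1), x.2 + t * (y.2 - x.2)).

Definition seg x y : set (R * R) := seg_point x y @` `[0, 1].

(** The coordinate along the unit vector of angle [c]. The pair [dirproj (c - pi / 2)], [dirproj c]
    gives the coordinates in a rotated orthonormal frame whose vertical axis has angle [c]. *)
Definition dirproj c p : R := p.1 * cos c + p.2 * sin c.

Lemma dirproj_seg_point c x y t :
  dirproj c (seg_point x y t) = dirproj c x + t * (dirproj c y - dirproj c x).
Proof. rewrite /dirproj /=; ring. Qed.

Lemma seg_point0 x y : seg_point x y 0 = x.
Proof. by rewrite /seg_point !mul0r !addr0 -surjective_pairing. Qed.

Lemma seg_point1 x y : seg_point x y 1 = y.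
Proof. by rewrite /seg_point !mul1r !subrKC -surjective_pairing. Qed.

Lemma seg_point_continuous x y : continuous (seg_point x y).
Proof.
move=> t.
have affine (a b : R) : (a + s * b) @[s --> t] --> a + t * b.
  by apply: cvgD; [exact: cvg_cst | apply: cvgMl; exact: cvg_id].
exact: (cvg_pair (affine _ _) (affine _ _)).
Qed.

Lemma dirproj_continuous c : continuous (dirproj c).
Proof.
move=> p; apply: cvgD; apply: cvgMl; [exact: cvg_fst|exact: cvg_snd].
Qed.

Lemma closed_seg x y : closed (seg x y).
Proof.
apply: compact_closed; first exact: norm_hausdorff.
apply: continuous_compact; last exact: segment_compact.
exact/continuous_subspaceT/seg_point_continuous.
Qed.

Lemma dirproj_IVT c (f : R -> R * R) (a b v : R) :
  0 <= a -> a <= b -> b <= 1 -> {within `[0, 1], continuous f} ->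
  dirproj c (f b) <= v <= dirproj c (f a) ->
  exists2 t, a <= t <= b & dirproj c (f t) = v.
Proof.
move=> a0 ab b1 fc /andP[v1 v2].
have fc' : {within `[a, b], continuous f}.
  apply: continuous_subspaceW fc => t /=.
  by rewrite !in_itv /= => /andP[? ?]; apply/andP; split; lra.
have [|||t] := @IVT R (dirproj c \o f) a b v.
- exact: ab.
- by apply: within_continuous_comp fc' => p _; exact: dirproj_continuous.
- by rewrite /= ge_min le_max v1 v2 orbT.
by rewrite in_itv /= => ? <-; exists t.
Qed.

Lemma seg_decr_left c x y p : dirproj c y < dirproj c x -> seg x y p ->
  dirproj c x <= dirproj c p -> p = x.
Proof.
move=> yx [t /=]; rewrite in_itv /= => /andP[t0 t1] <-.
rewrite dirproj_seg_point => h.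
have -> : t = 0 by nra.
exact: seg_point0.
Qed.

Lemma seg_decr_right c x y p : dirproj c y < dirproj c x -> seg x y p ->
  dirproj c p <= dirproj c y -> p = y.
Proof.
move=> yx [t /=]; rewrite in_itv /= => /andP[t0 t1] <-.
rewrite dirproj_seg_point => h.
have -> : t = 1 by nra.
exact: seg_point1.
Qed.

Lemma affine_between (u v t : R) : 0 <= t -> t <= 1 -> v <= u ->
  v <= u + t * (v - u) <= u.
Proof. by move=> t0 t1 vu; apply/andP; split; nra. Qed.

End PlaneGeometry.

(** * Height-monotone curves inside a zigzag *)

Section Zigzag.
Variables (R : realType) (V : finType) (E : rel V) (phi : V -> (R * R)%type).
Variables (c : R) (h : (R * R)%type -> R) (r : nat -> R) (N : nat).
Variable idx : V -> nat.
Hypothesis E_sym : symmetric E.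
Hypothesis idxN : forall v, (idx v < N)%N.
Hypothesis idx_inj : injective idx.
Hypothesis r_decr : forall a b : nat, (a < b)%N -> (b < N)%N -> r b < r a.
Hypothesis r_phi : forall v, dirproj c (phi v) = r (idx v).
Hypothesis h_alt : forall v, 0 < (-1) ^+ idx v * h (phi v).

(* [idx] lists the vertices from right to left, [r] is their horizontal
   coordinate and [h] the height, whose sign alternates by [h_alt]. *)
Definition zigzag : set (R * R) :=
  (\bigcup_(p in [set p : V * V | E p.1 p.2 /\ idx p.2 = (idx p.1).+1])
     seg (phi p.1) (phi p.2)) `|` range phi.

Lemma closed_zigzag : closed zigzag.
Proof.
apply: closedU.
  apply: closed_bigcup; first exact: finite_finset.
  by move=> p _; exact: closed_seg.
apply: (accessible_finite_set_closed.1 _); last exact: finite_image.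
exact/hausdorff_accessible/norm_hausdorff.
Qed.

Lemma r_leE (a b : nat) : (a < N)%N -> (b < N)%N -> (r b <= r a) = (a <= b)%N.
Proof.
move=> aN bN; have [ab|ba|->] := ssrnat.ltngtP a b; last exact: lexx.
  exact/ltW/r_decr.
by apply/negbTE; rewrite -ltNge; exact: r_decr.
Qed.

Lemma r_ltE (a b : nat) : (a < N)%N -> (b < N)%N -> (r b < r a) = (a < b)%N.
Proof. by move=> aN bN; rewrite ltNge r_leE// -ltnNge. Qed.

Lemma r_eqE (a b : nat) : (a < N)%N -> (b < N)%N -> r a = r b -> a = b.
Proof. by move=> aN bN ab; apply/eqP; rewrite eqn_leq -(r_leE aN bN) -(r_leE bN aN) ab lexx. Qed.

(** No value of [r] lies strictly between two consecutive ones, so a consecutive chord reaches the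
    coordinate [r a] only at one of its ends. *)
Lemma zigzag_vertex (a : nat) p : (a < N)%N -> zigzag p -> dirproj c p = r a ->
  exists2 v, idx v = a & p = phi v.
Proof.
move=> aN [[[u w] /= [_ uw] sp]|[v _ <-]] pa; last first.
  by exists v => //; apply: r_eqE => //; rewrite -r_phi.
have wu : dirproj c (phi w) < dirproj c (phi u) by rewrite !r_phi r_ltE// uw.
have [au|ua] := leqP a (idx u).
  have pu : p = phi u by apply: (seg_decr_left wu sp); rewrite pa r_phi r_leE.
  by exists u => //; apply: r_eqE => //; rewrite -r_phi -pu.
have pw : p = phi w by apply: (seg_decr_right wu sp); rewrite pa r_phi r_leE// uw.
by exists w => //; apply: r_eqE => //; rewrite -r_phi -pw.
Qed.

(** Over an open gap between consecutive coordinates the zigzag can only consist of the chord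
    spanning that gap, so a point there certifies the edge. *)
Lemma zigzag_between (a : nat) p : (a.+1 < N)%N -> zigzag p ->
  r a.+1 < dirproj c p < r a ->
  exists u w, [/\ E u w, idx u = a & idx w = a.+1].
Proof.
move=> aN zp /andP[p1 p2]; have aN' := ltnW aN.
case: zp => [[[u w] /= [Euw uw] [t /=]]|[v _ vp]]; last first.
  by move: p1 p2; rewrite -vp r_phi !r_ltE//; lia.
rewrite in_itv /= => /andP[t0 t1] tp.
exists u, w; suff ua : idx u = a by rewrite uw ua.
have wu : r (idx w) < r (idx u) by rewrite r_ltE// uw.
move: p1 p2; rewrite -tp dirproj_seg_point !r_phi.
have /andP[wz zu] := affine_between t0 t1 (ltW wu).
move=> p1 p2; apply/eqP; rewrite eqn_leq.
have := le_lt_trans wz p2; rewrite r_ltE // uw ltnS => ->.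
by have := lt_le_trans p1 zu; rewrite r_ltE // ltnS => ->.
Qed.

(** If [w] comes right after [u], any point of the curve over the gap certifies the edge. Otherwise
    the curve passes the next two corners in order, and heights of alternating sign are not
    monotone. The sign [s] allows both senses of monotonicity, since reversing a curve exchanges
    them. *)
Lemma zigzag_ascending (f : R -> R * R) (s : R) u w :
  {within `[0, 1], continuous f} ->
  (forall t, 0 <= t <= 1 -> zigzag (f t)) ->
  (s = 1 \/ s = -1) ->
  (forall a b, 0 <= a -> a <= b -> b <= 1 -> s * h (f a) <= s * h (f b)) ->
  f 0 = phi u -> f 1 = phi w -> (idx u < idx w)%N -> E u w.
Proof.
move=> fc fz s1 fm f0 f1 uw.
have wN := idxN w.
have r01 a : (a < N)%N -> (idx u <= a <= idx w)%N -> r (idx w) <= r a <= r (idx u).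
  by move=> aN; rewrite !r_leE// andbC.
move: (uw); rewrite leq_eqVlt => /predU1P[wE|uw2].
  have lt := r_decr uw wN.
  have [|||||t /andP[t0 t1] tE] := @dirproj_IVT R c f 0 1 ((r (idx u) + r (idx w)) / 2).
  - by [].
  - exact: ler01.
  - by [].
  - exact: fc.
  - by rewrite f0 f1 !r_phi; apply/andP; split; lra.
  have [|||u' [w' [E' u'E w'E]]] := @zigzag_between (idx u) (f t) _ (fz t _).
  - by rewrite wE.
  - by rewrite t0 t1.
  - by rewrite tE wE; apply/andP; split; lra.
  by rewrite -(idx_inj u'E); rewrite wE in w'E; rewrite -(idx_inj w'E).
have aN : ((idx u).+1 < N)%N by apply: leq_ltn_trans wN.
have aN2 : ((idx u).+2 < N)%N by apply: leq_ltn_trans wN.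
have [|||||t1 /andP[t10 t11] t1E] := @dirproj_IVT R c f 0 1 (r (idx u).+1).
- by [].
- exact: ler01.
- by [].
- exact: fc.
- by rewrite f0 f1 !r_phi r01// leqnSn ltnW.
have t1I : 0 <= t1 <= 1 by rewrite t10 t11.
(* Searching only after [t1] ensures that the second corner is met after the first. *)
have [|||t2 /andP[t20 t21] t2E] := @dirproj_IVT R c f t1 1 (r (idx u).+2) t10 t11.
- by [].
- exact: fc.
- by rewrite f1 t1E r_phi !r_leE ?leqnSn ?andbT // ltnW.
have t2I : 0 <= t2 <= 1 by rewrite t21 (le_trans t10 t20).
have [v1 v1E fv1] := zigzag_vertex aN (fz t1 t1I) t1E.
have [v2 v2E fv2] := zigzag_vertex aN2 (fz t2 t2I) t2E.
(* The heights at times [0], [t1], [t2] have signs [+ - +] or [- + -]. *)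
have := fm _ _ t10 t20 t21; have := fm _ _ (lexx 0) t10 t11.
rewrite f0 fv1 fv2.
have := h_alt u; have := h_alt v1; have := h_alt v2.
rewrite v1E v2E !exprS.
have [->|->] : (-1) ^+ idx u = 1 :> R \/ (-1) ^+ idx u = -1 :> R.
  by rewrite -signr_odd; case: odd; [right|left].
all: by case: s1 => ->; clear; move=> *; exfalso; lra.
Qed.

(** A curve running from left to right is reversed, which is harmless because [E] is symmetric. *)
Lemma zigzag_edge (f : R -> R * R) u w :
  {within `[0, 1], continuous f} ->
  (forall t, 0 <= t <= 1 -> zigzag (f t)) ->
  (forall a b, 0 <= a -> a <= b -> b <= 1 -> h (f a) <= h (f b)) ->
  f 0 = phi u -> f 1 = phi w -> u != w -> E u w.
Proof.
move=> fc fz fm f0 f1 uw.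
have [lt|lt|/idx_inj uwE] := ssrnat.ltngtP (idx u) (idx w); last by rewrite uwE eqxx in uw.
  apply: (@zigzag_ascending f 1 u w) => //; first by left.
  by move=> a b a0 ab b1; rewrite !mul1r; exact: fm.
rewrite E_sym.
pose g (t : R) := f (1 - t).
apply: (@zigzag_ascending g (-1) w u) => //.
- exact: within_continuous_flip.
- by move=> t /andP[t0 t1]; apply: fz; apply/andP; split; lra.
- by right.
- move=> a b a0 ab b1; rewrite !mulN1r lerN2; apply: fm; lra.
- by rewrite /g subr0.
- by rewrite /g subrr.
Qed.

End Zigzag.

(** * Polar angles, and segments as sector-monotone curves *)

Section Sectors.
Variable R : realType.
Implicit Types (x y p : (R * R)%type) (c t r : R).

Lemma polar_coordinates p : exists r theta : R,
  [/\ 0 <= r, 0 <= theta < pi *+ 2 & p = (r * cos theta, r * sin theta)].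
Proof.
case: p => a b; set r := Num.sqrt (a ^+ 2 + b ^+ 2).
have r2 : r ^+ 2 = a ^+ 2 + b ^+ 2 by rewrite sqr_sqrtr// addr_ge0// sqr_ge0.
have r0 : 0 <= r by exact: sqrtr_ge0.
have pi0 := pi_gt0 R.
have [rE|rN0] := eqVneq r 0.
  exists 0, 0; rewrite !mul0r lexx mulrn_wgt0//; split => //.
  have a0 : a = 0 by nra.
  have b0 : b = 0 by nra.
  by rewrite a0 b0.
have r_gt0 : 0 < r by rewrite lt_neqAle eq_sym rN0.
pose u := a / r; have aE : a = r * u by rewrite /u; field.
have u1 : u ^+ 2 + (b / r) ^+ 2 = 1.
  by rewrite /u !expr_div_n -mulrDl -r2 divff// expf_neq0.
have u11 : -1 <= u <= 1 by apply/andP; split; nra.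
have sinE : r * sin (acos u) = `|b|.
  rewrite sin_acos//; have -> : 1 - u ^+ 2 = (b / r) ^+ 2 by lra.
  rewrite sqrtr_sqr normrM normfV (ger0_norm r0); field.
  exact: rN0.
have cosE : r * cos (acos u) = a by rewrite acosK// in_itv.
have [b0|b0] := leP 0 b.
  exists r, (acos u); rewrite cosE sinE ger0_norm//; split => //.
  by rewrite acos_ge0//=; have := acos_lepi u11; rewrite mulr2n; lra.
(* In the open lower half-plane [u < 1], so [acos u > 0] and the angle stays below [2 * pi]. *)
exists r, (pi *+ 2 - acos u).
have br : 0 < (b / r) ^+ 2 by rewrite exprn_even_gt0//= mulf_neq0 ?invr_eq0// lt_eqF.
have u_lt1 : -1 <= u < 1 by apply/andP; split; nra.
split => //.
  by have := acos_gt0 u_lt1; have := acos_lepi u11; rewrite mulr2n => ? ?; apply/andP; split; lra.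
rewrite cosB sinB cos2pi sin2pi !mul1r !mul0r addr0 sub0r mulrN cosE sinE.
by rewrite ltr0_norm// opprK.
Qed.

Lemma seg_in_sector (k : nat) x y : (0 < k)%N -> exists2 m : nat, (m < 2 * k)%N &
  forall a b : R, a <= b -> sector k m (seg_point x y a) (seg_point x y b).
Proof.
move=> k0; have [r [theta [r0 /andP[th0 th2] [xE yE]]]] :=
  polar_coordinates (y.1 - x.1, y.2 - x.2).
have pi0 := pi_gt0 R.
have kR : 0 < k%:R :> R by rewrite ltr0n.
pose z := theta * k%:R / pi.
have z0 : 0 <= z by rewrite /z divr_ge0 ?mulr_ge0// ltW.
have kN0 : k%:R != 0 :> R by rewrite gt_eqF.
have piN0 : pi != 0 :> R by rewrite gt_eqF.
have thE : theta = z * pi / k%:R by rewrite /z divfK // mulfK.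
have /andP[m1 m2] := truncn_itv z0.
(* [z] is the direction of the segment measured in sector widths [pi / k]; its integer part is the
   sector number, below [2 * k] because [theta < 2 * pi]. *)
exists (Num.truncn z).
  rewrite truncn_lt_nat// natrM /z ltr_pdivrMr// mulrAC ltr_pM2r//.
  by rewrite mulr_natl.
move=> a b ab; exists ((b - a) * r), theta; split.
- by rewrite mulr_ge0// subr_ge0.
- by rewrite thE ler_pM2r ?invr_gt0// ler_pM2r.
- by rewrite thE ler_pM2r ?invr_gt0// ler_pM2r// ltW.
- by rewrite /seg_point /= xE yE; congr pair; ring.
Qed.

Definition circle_point (t : R) : R * R := (cos t, sin t).

Lemma dirproj_circle_point c t : dirproj c (circle_point t) = cos (t - c).
Proof. by rewrite cosB. Qed.

Lemma dirproj_inj c x y :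
  dirproj (c - pi / 2) x = dirproj (c - pi / 2) y -> dirproj c x = dirproj c y ->
  x = y.
Proof.
rewrite /dirproj cosBpihalf sinBpihalf; have := cos2Dsin2 c.
case: x y => [x1 x2] [y1 y2] /=; move: (cos c) (sin c) => C S CS e1 e2.
have rot (z1 z2 : R) : z1 = (z1 * C + z2 * S) * C + (z1 * S + z2 * - C) * S
    /\ z2 = (z1 * C + z2 * S) * S - (z1 * S + z2 * - C) * C.
  by split; rewrite -[LHS]mulr1 -CS; ring.
by congr pair; [rewrite (rot x1 x2).1 e1 e2 -(rot y1 y2).1
               |rewrite (rot x1 x2).2 e1 e2 -(rot y1 y2).2].
Qed.

(** * Polygon corners and chords in the frame of a sector *)

Variable k : nat.
Hypothesis k_gt0 : (0 < k)%N.

(** A quarter of the sector angle, used as the angular unit so that the angles of corners and chords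
    become integer multiples of it. *)
Definition tau : R := pi / (4 * k)%:R.

Lemma tau_gt0 : 0 < tau.
Proof. by rewrite divr_gt0 ?pi_gt0// ltr0n muln_gt0. Qed.

Lemma pi_tau : pi = (4 * k)%:R * tau.
Proof. by rewrite mulrC divfK// pnatr_eq0 muln_eq0 -lt0n k_gt0. Qed.

(* This is [(m + 1/2) * pi / k], the bisector of the sector [m], whose half-angle
   is [2 * tau]. *)
Definition sector_axis (m : nat) : R := (4 * m + 2)%:R * tau.

Lemma sin_2tau_gt0 : 0 < sin (2 * tau).
Proof.
apply: sin_gt0_pi; rewrite mulr_gt0 ?tau_gt0//= pi_tau.
by rewrite ltr_pM2r ?tau_gt0// ltr_nat; lia.
Qed.

(** Equality occurs for [k = 1], where the half-angle [2 * tau] is [pi / 2]. *)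
Lemma cos_2tau_ge0 : 0 <= cos (2 * tau).
Proof.
have t0 := tau_gt0.
have k1 : 1 <= k%:R :> R by rewrite ler1n.
apply: cos_ge0_pihalf; rewrite pi_tau natrM; apply/andP; split; nra.
Qed.

(** The displacement makes an angle [d] with [-2 * tau <= d <= 2 * tau] with the axis. The slope
    bound by [tan (2 * tau)] is kept multiplied out because the cosine may vanish; it amounts to
    [sin (2 * tau - d)] and [sin (2 * tau + d)] being nonnegative. *)
Lemma sector_cone (m : nat) x y : sector k m x y ->
  `|dirproj (sector_axis m - pi / 2) y - dirproj (sector_axis m - pi / 2) x| * cos (2 * tau)
    <= (dirproj (sector_axis m) y - dirproj (sector_axis m) x) * sin (2 * tau).
Proof.
case=> r [theta [r0 th1 th2 ->]].
have projE c : dirproj c (x.1 + r * cos theta, x.2 + r * sin theta) - dirproj c x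
    = r * cos (theta - c) by rewrite cosB /dirproj /=; ring.
rewrite !projE opprB addrA addrAC cosDpihalf mulrN normrN normrM ger0_norm//.
rewrite -!mulrA ler_wpM2l//; set d := theta - _.
have t0 := tau_gt0.
have thtau (n : nat) : n%:R * pi / k%:R = (4 * n)%:R * tau.
  by rewrite /tau !natrM; field; rewrite pnatr_eq0 -lt0n.
move: th1 th2; rewrite !thtau => th1 th2.
have d1 : - (2 * tau) <= d.
  by rewrite /d /sector_axis; move: th1; rewrite !natrM natrD; lra.
have d2 : d <= 2 * tau.
  by rewrite /d /sector_axis; move: th2; rewrite -natr1 !natrM natrD; lra.
have pi4 : 4 * tau <= pi.
  rewrite pi_tau ler_pM2r// ler_nat; lia.
have s1 : 0 <= sin (2 * tau - d) by apply: sin_ge0_pi; apply/andP; split; lra.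
have s2 : 0 <= sin (2 * tau + d) by apply: sin_ge0_pi; apply/andP; split; lra.
rewrite sinB in s1; rewrite sinD in s2.
rewrite -[leLHS]ger0_norm ?mulr_ge0 ?cos_2tau_ge0// normrM normr_id -normrM.
by rewrite ler_norml; apply/andP; split; lra.
Qed.

(* The corner [j] has angle [j * pi / k] plus a phase for which, in the frame of
   every sector, the corners have odd angles [(4 * i + 1) * tau]; hence their
   horizontal coordinates are distinct. *)
Definition vertex (j : nat) : R * R :=
  circle_point ((4 * j + 3)%:R * tau - pi / 2).

Lemma vertex_inj (i j : nat) : (i < 2 * k)%N -> (j < 2 * k)%N ->
  vertex i = vertex j -> i = j.
Proof.
wlog ij : i j / (i < j)%N.
  move=> W i2 j2 ijE; have [lt|lt|//] := ssrnat.ltngtP i j; first exact: W.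
  by apply/esym/W.
move=> i2 j2 [cE sE]; exfalso.
(* Equal points force [1 - cos d = 0] for the angle difference [d], whereas
   [1 - cos d = 2 * sin (d / 2) ^ 2] is positive for [0 < d / 2 < pi]. *)
have /(congr1 (fun z => 1 - z)) := cosB ((4 * j + 3)%:R * tau - pi / 2)
   ((4 * i + 3)%:R * tau - pi / 2).
rewrite cE sE -!expr2 cos2Dsin2 subrr.
set d := (4 * j + 3)%:R * tau - pi / 2 - _ => dE.
have dd : d = ((2 * (j - i))%:R * tau) *+ 2.
  by rewrite /d -(subnK (ltnW ij)) addnK; ring.
have : 0 < sin ((2 * (j - i))%:R * tau).
  apply: sin_gt0_pi; rewrite mulr_gt0 ?tau_gt0//= ?ltr0n; last by lia.
  rewrite pi_tau ltr_pM2r ?tau_gt0// ltr_nat; lia.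
move: dE; rewrite dd cos_mulr2n; have := cos2Dsin2 ((2 * (j - i))%:R * tau).
by move=> ? ? ?; nra.
Qed.

(** In the frame of a sector, the corner with position [a] from right to left has angle
    [(-1) ^ a * zig_angle a]. *)
Definition zig_angle (a : nat) : R := (2 * a + 1)%:R * tau.

Lemma zig_angle_itv (a : nat) : (a < 2 * k)%N -> 0 < zig_angle a < pi.
Proof.
move=> ak; rewrite mulr_gt0 ?tau_gt0 ?ltr0n ?addn1//= pi_tau.
rewrite ltr_pM2r ?tau_gt0// ltr_nat; lia.
Qed.

Lemma cos_zig_angle_decr (a b : nat) : (a < b)%N -> (b < 2 * k)%N ->
  cos (zig_angle b) < cos (zig_angle a).
Proof.
move=> ab bk; have /andP[a0 api] := zig_angle_itv (ltn_trans ab bk).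
have /andP[b0 bpi] := zig_angle_itv bk.
rewrite ltr_cos ?in_itv /= ?(ltW a0) ?(ltW b0) ?(ltW api) ?(ltW bpi)//.
by rewrite ltr_pM2r ?tau_gt0// ltr_nat; lia.
Qed.

(** In the frame the corner has angle [(4 * (j - m) + 1) * tau]. Reduced modulo
    [2 * pi = 8 * k * tau] to the interval from [-pi] to [pi], it is [(4 * d + 1) * tau], giving an
    even position, or [-(4 * d + 3) * tau], giving an odd one. *)
Lemma vertex_zig (j m : nat) : (j < 2 * k)%N -> (m < 2 * k)%N ->
  exists a : nat, [/\ (a < 2 * k)%N,
    dirproj (sector_axis m - pi / 2) (vertex j) = cos (zig_angle a) &
    dirproj (sector_axis m) (vertex j) = (-1) ^+ a * sin (zig_angle a)].
Proof.
move=> jk mk; rewrite !dirproj_circle_point.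
set X := _ - (sector_axis m - pi / 2).
have -> : (4 * j + 3)%:R * tau - pi / 2 - sector_axis m = X - pi / 2.
  by rewrite /X; ring.
rewrite cosBpihalf.
have XE : X = (4 * j + 1)%:R * tau - (4 * m)%:R * tau.
  by rewrite /X /sector_axis; ring.
have even (d : nat) : (-1) ^+ d.*2 = 1 :> R by rewrite -signr_odd odd_double.
have odd (d : nat) : (-1) ^+ d.*2.+1 = -1 :> R by rewrite -signr_odd /= odd_double.
have pos (d : nat) : (d < k)%N -> cos X = cos (zig_angle d.*2) ->
    sin X = sin (zig_angle d.*2) -> exists a : nat, [/\ (a < 2 * k)%N,
    cos X = cos (zig_angle a) & sin X = (-1) ^+ a * sin (zig_angle a)].
  by move=> dk cE sE; exists d.*2; rewrite even mul1r; split => //; lia.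
have neg (d : nat) : (d < k)%N -> cos X = cos (- zig_angle d.*2.+1) ->
    sin X = sin (- zig_angle d.*2.+1) -> exists a : nat, [/\ (a < 2 * k)%N,
    cos X = cos (zig_angle a) & sin X = (-1) ^+ a * sin (zig_angle a)].
  move=> dk; rewrite cosN sinN => cE sE; exists d.*2.+1.
  by rewrite odd mulN1r; split => //; lia.
have XpE : X + pi *+ 2 = (4 * j + 1 + 8 * k)%:R * tau - (4 * m)%:R * tau.
  by rewrite XE pi_tau; ring.
have XmE : X - pi *+ 2 = (4 * j + 1)%:R * tau - (4 * m + 8 * k)%:R * tau.
  by rewrite XE pi_tau; ring.
have cosm : cos (X - pi *+ 2) = cos X by rewrite -[in RHS](subrK (pi *+ 2) X) cosD2pi.
have sinm : sin (X - pi *+ 2) = sin X by rewrite -[in RHS](subrK (pi *+ 2) X) sinD2pi.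
(* Four ranges of the integer [j - m]: only when it is at least [k] or less than [-k] is a full turn
   subtracted or added. *)
have [mj|jm] := leqP m j.
  have [d_lt|d_ge] := ltnP (j - m) k.
    have Xz : X = zig_angle (j - m).*2.
      by rewrite XE -mulrBl -natrB; [congr (_%:R * _)|]; lia.
    by apply: (pos (j - m)%N) => //; rewrite Xz.
  have Xz : X - pi *+ 2 = - zig_angle (2 * k - (j - m)).-1.*2.+1.
    by rewrite XmE -mulrBl -mulNr -opprB -natrB; [congr (- _%:R * _)|]; lia.
  by apply: (neg (2 * k - (j - m)).-1); [lia|rewrite -Xz ?cosm ?sinm..].
have [d_le|d_gt] := leqP (m - j) k.
  have Xz : X = - zig_angle (m - j).-1.*2.+1.
    by rewrite XE -mulrBl -mulNr -opprB -natrB; [congr (- _%:R * _)|]; lia.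
  by apply: (neg (m - j).-1); [lia|rewrite -Xz..].
have Xz : X + pi *+ 2 = zig_angle (2 * k - (m - j)).*2.
  by rewrite XpE -mulrBl -natrB; [congr (_%:R * _)|]; lia.
by apply: (pos (2 * k - (m - j))%N); [lia|rewrite -Xz ?cosD2pi ?sinD2pi..].
Qed.

(** Positivity of [sin (t - 2 * tau)] and [sin (t + 2 * tau)], expanded, bounds [cos t] from both
    sides. *)
Lemma outside_cone t : 2 * tau < t -> t < pi - 2 * tau ->
  `|cos t| * sin (2 * tau) < sin t * cos (2 * tau).
Proof.
move=> t1 t2; have t0 := tau_gt0.
have s1 : 0 < sin (t - 2 * tau) by apply: sin_gt0_pi; apply/andP; split; lra.
have s2 : 0 < sin (t + 2 * tau) by apply: sin_gt0_pi; apply/andP; split; lra.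
rewrite sinB in s1; rewrite sinD in s2.
rewrite -(gtr0_norm sin_2tau_gt0) -normrM ltr_norml.
by apply/andP; split; lra.
Qed.

(** With [S] and [D] the half-sum and half-difference of the two angles, the horizontal difference
    is [-2 * sin S * sin D], and the vertical one is, up to sign, [2 * sin D * cos S] for equal
    parities and [2 * sin S * cos D] otherwise. Cancelling the common factor leaves [outside_cone]
    at [S] or at [D]. *)
Lemma chord_outside_cone (a b : nat) : (a < 2 * k)%N -> (b < 2 * k)%N ->
  a <> b -> b <> a.+1 -> a <> b.+1 ->
  `|(-1) ^+ b * sin (zig_angle b) - (-1) ^+ a * sin (zig_angle a)| * sin (2 * tau)
  < `|cos (zig_angle b) - cos (zig_angle a)| * cos (2 * tau).
Proof.
wlog ab : a b / (a < b)%N.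
  move=> W ak bk nab nba1 nab1; have [lt|lt|//] := ssrnat.ltngtP a b; first exact: W.
  by rewrite distrC [in ltRHS]distrC; apply: W => // /esym.
move=> ak bk nab nba1 _; have t0 := tau_gt0.
pose S := (a + b + 1)%:R * tau; pose D := (b - a)%:R * tau.
have aE : zig_angle a = S - D.
  rewrite /S /D -mulrBl -natrB; last by lia.
  by congr (_%:R * _); lia.
have bE : zig_angle b = S + D by rewrite /S /D -mulrDl -natrD; congr (_%:R * _); lia.
have Spos : 0 < sin S.
  apply: sin_gt0_pi; rewrite /S mulr_gt0 ?ltr0n ?addn1//= pi_tau.
  by rewrite ltr_pM2r// ltr_nat; lia.
have Dpos : 0 < sin D.
  apply: sin_gt0_pi; rewrite /D mulr_gt0 ?ltr0n ?subn_gt0//= pi_tau.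
  by rewrite ltr_pM2r// ltr_nat; lia.
have tau_itv (n : nat) : (2 < n)%N -> (n + 2 < 4 * k)%N ->
    `|cos (n%:R * tau)| * sin (2 * tau) < sin (n%:R * tau) * cos (2 * tau).
  move=> n2 n4; apply: outside_cone; first by rewrite ltr_pM2r// ltr_nat.
  by rewrite pi_tau -mulrBl ltr_pM2r// ltrBrDr -natrD ltr_nat.
have -> : cos (zig_angle b) - cos (zig_angle a) = - (2 * (sin S * sin D)).
  by rewrite aE bE cosD cosB; ring.
rewrite normrN normrM (ger0_norm (ltW (mulr_gt0 Spos Dpos))) ger0_norm//.
have [par|par] := boolP (odd a == odd b).
  have -> : (-1) ^+ b * sin (zig_angle b) - (-1) ^+ a * sin (zig_angle a)
      = (-1) ^+ a * (2 * sin D * cos S).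
    by rewrite -(signr_odd _ b) -(eqP par) signr_odd aE bE sinD sinB; ring.
  have := tau_itv (a + b + 1)%N.
  rewrite -/S normrM normrX normrN1 expr1n mul1r normrM ger0_norm ?mulr_ge0 ?ltW//.
  (* Equal parity and [a < b] give [b >= a + 2], so the multiple [a + b + 1] lies between [3] and
     [4 * k - 3]. *)
  move=> H; have {}H : `|cos S| * sin (2 * tau) < sin S * cos (2 * tau).
    by apply: H; lia.
  have -> : 2 * sin D * `|cos S| * sin (2 * tau)
    = (2 * sin D) * (`|cos S| * sin (2 * tau)) by ring.
  have -> : 2 * (sin S * sin D) * cos (2 * tau)
    = (2 * sin D) * (sin S * cos (2 * tau)) by ring.
  by rewrite ltr_pM2l ?mulr_gt0.
have -> : (-1) ^+ b * sin (zig_angle b) - (-1) ^+ a * sin (zig_angle a)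
    = (-1) ^+ b * (2 * sin S * cos D).
  have -> : (-1) ^+ a = - (-1) ^+ b :> R.
    rewrite -(signr_odd _ a) -(signr_odd _ b).
    by move: par; case: (odd a); case: (odd b) => // _; rewrite ?opprK.
  by rewrite aE bE sinD sinB; ring.
have := tau_itv (b - a)%N.
rewrite -/D normrM normrX normrN1 expr1n mul1r normrM ger0_norm ?mulr_ge0 ?ltW//.
(* Different parities and [b <> a.+1] give [b - a >= 3]; consecutive corners would have [D = tau],
   outside the admissible range. *)
move=> H; have {}H : `|cos D| * sin (2 * tau) < sin D * cos (2 * tau).
  by apply: H; lia.
have -> : 2 * sin S * `|cos D| * sin (2 * tau)
  = (2 * sin S) * (`|cos D| * sin (2 * tau)) by ring.
have -> : 2 * (sin S * sin D) * cos (2 * tau)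
  = (2 * sin S) * (sin D * cos (2 * tau)) by ring.
by rewrite ltr_pM2l ?mulr_gt0.
Qed.

End Sectors.

(** * Sector-monotone curves inside the drawing *)

Section Drawing.
Variables (R : realType) (V : finType) (E : rel V) (k : nat).
Hypothesis E_sym : symmetric E.
Hypothesis E_irr : irreflexive E.
Hypothesis k_gt0 : (0 < k)%N.
Hypothesis card_V : (#|V| <= 2 * k)%N.

Definition position (v : V) : R * R := vertex R k (enum_rank v).

Definition drawing : set (R * R) :=
  \bigcup_(p in [set p : V * V | E p.1 p.2]) seg (position p.1) (position p.2).

Lemma rank_lt (v : V) : (enum_rank v < 2 * k)%N.
Proof. exact: leq_trans (ltn_ord _) card_V. Qed.

Lemma position_inj : injective position.
Proof.
by move=> u w /(vertex_inj k_gt0 (rank_lt u) (rank_lt w))/val_inj/enum_rank_inj.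
Qed.

Lemma delta_monotone_seg_point (x y : (R * R)%type) :
  delta_monotone k (seg_point x y).
Proof.
rewrite /delta_monotone; case: eqP => _; last first.
  by have [m mk H] := seg_in_sector x y k_gt0; exists m => // a b _ ab _; exact: H.
have [xy|yx] := leP x.1 y.1; [left|right] => a b _ ab _ /=.
  by rewrite lerD2l ler_wpM2r// subr_ge0.
by rewrite lerD2l ler_wnM2r// subr_le0 ltW.
Qed.

Lemma sector_monotone_adjacent (f : R -> R * R) (u w : V) :
  {within `[0, 1], continuous f} -> sector_monotone k f ->
  (forall t, 0 <= t <= 1 -> drawing (f t)) ->
  f 0 = position u -> f 1 = position w -> u != w -> E u w.
Proof.
move=> fc [m mk fm] fF f0 f1 uw.
(* The frame of the sector: [B] is the vertical direction and [A] the horizontal one. *)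
set B := sector_axis R k m; set A := B - pi / 2.
have /choice[idx idxP] : forall v : V, exists a : nat, [/\ (a < 2 * k)%N,
    dirproj A (position v) = cos (zig_angle R k a) &
    dirproj B (position v) = (-1) ^+ a * sin (zig_angle R k a)].
  by move=> v; apply: vertex_zig => //; exact: rank_lt.
have idxN v : (idx v < 2 * k)%N by case: (idxP v).
have idxA v : dirproj A (position v) = cos (zig_angle R k (idx v)) by case: (idxP v).
have idxB v : dirproj B (position v) = (-1) ^+ idx v * sin (zig_angle R k (idx v)).
  by case: (idxP v).
have idx_inj : injective idx.
  by move=> v v' vv'; apply/position_inj/(@dirproj_inj _ B); rewrite -/A ?idxA ?idxB vv'.
have cone s t : 0 <= s -> s <= t -> t <= 1 ->
    `|dirproj A (f t) - dirproj A (f s)| * cos (2 * tau R k)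
    <= (dirproj B (f t) - dirproj B (f s)) * sin (2 * tau R k).
  by move=> s0 st t1; exact: sector_cone (fm _ _ s0 st t1).
have sin_gt0 := sin_2tau_gt0 R k_gt0.
have cos_ge0 := cos_2tau_ge0 R k_gt0.
(* Two distinct points on a chord between non-consecutive corners differ by a multiple of the chord
   direction, which lies outside the cone containing every displacement of [f]. *)
have far_unique s t v v' : 0 <= s -> s <= t -> t <= 1 ->
    E v v' -> idx v' <> (idx v).+1 -> idx v <> (idx v').+1 ->
    seg (position v) (position v') (f s) -> seg (position v) (position v') (f t) ->
    f s = f t.
  move=> s0 st t1 Evv far1 far2 [a _ aE] [b _ bE].
  have [ba|ba] := eqVneq b a; first by rewrite -aE -bE ba.
  have : idx v <> idx v' by move=> /idx_inj vv; rewrite vv E_irr in Evv.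
  move=> /(chord_outside_cone R k_gt0 (idxN v) (idxN v'))/(_ far1 far2).
  rewrite -!idxA -!idxB; set D := dirproj A _ - _; set D' := dirproj B _ - _.
  have {}ba : 0 < `|b - a| by rewrite normr_gt0 subr_eq0.
  rewrite -(ltr_pM2l ba) [ltLHS]mulrA [ltRHS]mulrA -!normrM.
  have := cone s t s0 st t1; rewrite -aE -bE !dirproj_seg_point.
  have affB (z d : R) : z + b * d - (z + a * d) = (b - a) * d by ring.
  rewrite !affB -/D -/D'.
  move=> le lt; have := lt_le_trans lt le.
  by rewrite ltr_pM2r// ltNge ler_norm.
have Z t : 0 <= t <= 1 -> zigzag E position idx (f t).
  pose far := [set p : V * V | [/\ E p.1 p.2, idx p.2 <> (idx p.1).+1 &
    idx p.1 <> (idx p.2).+1]].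
  pose I := f @` `[0, 1].
  pose X := \bigcup_(p in far) (I `&` seg (position p.1) (position p.2)).
  suff IZ : I `<=` zigzag E position idx.
    by move=> t01; apply: IZ; exists t; rewrite //= in_itv.
  (* [X] is finite: there are finitely many far chords, and each meets the image in at most one
     point. *)
  apply: (@connected_sub_closed _ _ _ X).
  - exact/hausdorff_accessible/norm_hausdorff.
  - apply: connected_continuous_connected fc; exact: segment_connected.
  - exact: closed_zigzag.
  - apply: bigcup_finite; first exact: finite_finset.
    move=> [v v'] [/= Evv far1 far2].
    set Y := _ `&` _; have [[p Yp]|nY] := pselect (Y !=set0); last first.
      by suff -> : Y = set0 by []; apply/eqP/negPn/negP => /set0P.
    apply: (@sub_finite_set _ _ [set p]) => // q Yq /=.
    move: Yp Yq => [[s s01 <-] fs] [[r r01 <-] fr].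
    move: s01 r01; rewrite /= !in_itv /= => /andP[s0 s1] /andP[r0 r1].
    have [sr|/ltW rs] := leP s r; first by rewrite (far_unique s r v v').
    by rewrite (far_unique r s v v').
  - move=> p [s /=]; rewrite in_itv /= => s01 <-.
    have [[v v'] /= Evv sv] := fF s s01.
    have [n1|n1] := pselect (idx v' = (idx v).+1).
      by left; left; exists (v, v').
    have [n2|n2] := pselect (idx v = (idx v').+1).
      left; left; exists (v', v); first by rewrite /= E_sym.
      case: sv => r /=; rewrite in_itv /= => /andP[r0 r1] <-.
      exists (1 - r); first by rewrite /= in_itv /=; apply/andP; split; lra.
      by rewrite /seg_point; congr pair; ring.
    right; exists (v, v') => //; split => //.
    by exists s; rewrite //= in_itv.
  (* Including the corners themselves in the zigzag provides this common point even if no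
     consecutive chord ends at [u]. *)
  exists (position u); split; last by right; exists u.
  by exists 0; rewrite //= in_itv /= lexx ler01.
apply: (@zigzag_edge R V E position A (dirproj B)
  (fun a => cos (zig_angle R k a)) (2 * k) idx E_sym idxN idx_inj _ idxA _ f u w) => //.
- move=> a b; exact: cos_zig_angle_decr.
- move=> v; rewrite idxB mulrA -expr2 sqrr_sign mul1r.
  exact/sin_gt0_pi/zig_angle_itv.
(* The left side of the cone bound is nonnegative and [sin (2 * tau)] is positive, so the height
   cannot decrease. *)
- move=> a b a0 ab b1; rewrite -subr_ge0 -(pmulr_lge0 _ sin_gt0).
  by apply: le_trans (cone _ _ a0 ab b1); rewrite mulr_ge0.
Qed.

End Drawing.

(** * The obstacle representation *)

Theorem theorem4 (R : realType) (V : finType) (E : rel V) (n : nat)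
    (E_sym : symmetric E) (E_irr : irreflexive E)
    (card_V : #|V| = n) (n_ge1 : (1 <= n)%N) :
  exists (phi : V -> (R * R)%type) (S : set (set (R * R)%type)),
    obstacle_representation (uphalf n) E phi S.
Proof.
have k_gt0 : (0 < uphalf n)%N by rewrite uphalf_gt0.
have card2 : (#|V| <= 2 * uphalf n)%N by rewrite card_V; lia.
(* Each obstacle is a single point, hence connected. *)
exists (@position R V (uphalf n)), [set [set x] | x in ~` drawing E (uphalf n)].
split; first exact: position_inj.
  by move=> _ [x _ <-]; exact: connected1.
move=> u w uw; split=> [Euw|[f [[fc fm] f0 f1 fS]]].
  exists (seg_point (position R (uphalf n) u) (position R (uphalf n) w)).
  split; [split| | |].
  - exact/continuous_subspaceT/seg_point_continuous.
  - exact: delta_monotone_seg_point.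
  - exact: seg_point0.
  - exact: seg_point1.
  apply/seteqP; split => // p [[t t01 tp] [_ [x nx <-] /= px]].
  by apply: nx; exists (u, w) => //; rewrite -px -tp; exists t.
have fF t : 0 <= t <= 1 -> drawing E (uphalf n) (f t).
  move=> t01; apply: contrapT => nF.
  have : (set0 : set (R * R)) (f t) by rewrite -fS; split; [exists t; rewrite //= in_itv|exists [set f t] => //; exists (f t)].
  by [].
move: fm; rewrite /delta_monotone; case: eqP => [k1 _|_ fm]; last first.
  exact: (sector_monotone_adjacent E_sym E_irr k_gt0 card2 fc fm fF).
(* For [k = 1] geodesics are only monotone in the first coordinate, so the sector argument is
   replaced by counting: [f 0] lies on some drawn edge, and with at most two vertices that edge must
   join [u] and [w]. *)
have [|[v v'] /= Evv _] := fF 0; first by rewrite lexx ler01.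
have V2 : (#|V| <= 2)%N by rewrite k1 in card2.
have vv' : v != v' by apply: contraTneq Evv => ->; rewrite E_irr.
have uw2 : #|[set u; w]%SET| = 2%N by rewrite cards2 uw.
have fullV : [set u; w]%SET = [set: V]%SET.
  by apply/eqP; rewrite eqEcard finset.subsetT cardsT uw2.
have /set2P vP : v \in [set u; w]%SET by rewrite fullV inE.
have /set2P v'P : v' \in [set u; w]%SET by rewrite fullV inE.
by case: vP v'P vv' Evv => -> [] ->; rewrite ?eqxx // E_sym.
Qed.
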